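(* Let $G$ and $H$ be groups acting on themselves and on each other fully compatibly. If $\overline{D_H(G)}$ is locally cyclic, then $G\boxtimes H$ is abelian.
   Context: All actions are left actions by automorphisms. $G$ and $H$ act on themselves and on each other through homomorphisms $\rho_G\colon G\to \mathrm{Aut}(G)$, $\rho_H\colon H\to\mathrm{Aut}(H)$, $\sigma_G\colon G\to\mathrm{Aut}(H)$, $\sigma_H\colon H\to \mathrm{Aut}(G)$ (a group need not act on itself by conjugation). For $a,b\in G\cup H$ (disjoint union), ${}^{a}b$ denotes the result of acting by $a$ on $b$. The actions are fully compatible if ${}^{({}^{a}b)}c={}^{a}\big({}^{b}({}^{a^{-1}}c)\big)$ for all $a,b,c\in G\cup H$. The box-tensor product $G\boxtimes H$ is the group generated by the symbols $g\boxtimes h$ ($g\in G$, $h\in H$) subject to the relations $gg'\boxtimes h=({}^{g}g'\boxtimes {}^{g}h)(g\boxtimes h)$ and $g\boxtimes hh'=(g\boxtimes h)({}^{h}g\boxtimes {}^{h}h')$ for all $g,g'\in G$, $h,h'\in H$. The derivative of $G$ by $H$ is the subgroup $D_H(G)=\langle g\cdot{}^{h}(g^{-1})\mid g\in G,h\in H\rangle$ of $G$. The deviational subgroup $D_\rho(G)$ is the normal closure in $G$ of $\{{}^{g}g'\cdot gg'^{-1}g^{-1}\mid g,g'\in G\}$, where ${}^{g}g'=\rho_G(g)(g')$. Set $\overline{D_H(G)}=D_H(G)D_\rho(G)/D_\rho(G)$. A group is locally cyclic if every finitely generated subgroup is cyclic. *)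

(* Defs.v *)
From HB Require Import structures.
From mathcomp Require Import all_boot.
From mathcomp Require Import boolp classical_sets cardinality.

Set Implicit Arguments.
Unset Strict Implicit.
Unset Printing Implicit Defensive.

Local Open Scope classical_set_scope.
Local Open Scope quotient_scope.
Local Open Scope group_scope.

Section Subgroups.
Variable G : groupType.
Implicit Types A S : set G.

Definition subgroup S := group_closed (fun x => x \in S).

Definition normal_subgroup S :=
  subgroup S /\ (forall x y, S x -> S (x ^ y)).

Definition generated A : set G := smallest subgroup A.

Definition normal_closure A : set G := smallest normal_subgroup A.

Definition cyclic S := exists x, S = generated [set x].

Definition finitely_generated S := exists2 A, finite_set A & S = generated A.

(* T, being generated, is a subgroup; S is meant to be one. *)
Definition locally_cyclic S :=
  forall T, T `<=` S -> finitely_generated T -> cyclic T.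

Lemma subgroupP S :
  subgroup S <-> S 1 /\ (forall x y, S x -> S y -> S (x / y)).
Proof.
split=> -[S1 SF]; split.
- exact: set_mem S1.
- by move=> x y Sx Sy; apply: set_mem; apply: SF; apply: mem_set.
- exact: mem_set S1.
- by move=> x y Sx Sy; apply: mem_set; apply: SF; apply: set_mem.
Qed.

Lemma normal_closure_normal A : normal_subgroup (normal_closure A).
Proof.
split.
  apply/subgroupP; split.
    by move=> S [[/subgroupP[S1 _] _] _].
  move=> x y Ax Ay S SA; have [[/subgroupP[_ SF] _] _] := SA.
  by apply: SF; [apply: Ax | apply: Ay].
by move=> x y Ax S SA; have [[_ SJ] _] := SA; apply: SJ; apply: Ax.
Qed.

End Subgroups.

Record normalSubgroup (G : groupType) := NormalSubgroup {
  normal_set :> set G;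
  normal_setP : normal_subgroup normal_set }.

Section QuotientGroup.
Variables (G : groupType) (N : normalSubgroup G).

Let N1 : normal_set N 1.
Proof. by case: (normal_setP N) => /subgroupP[]. Qed.
Let NF x y : normal_set N x -> normal_set N y -> normal_set N (x / y).
Proof. by case: (normal_setP N) => /subgroupP[_ +] _; apply. Qed.
Let NV x : normal_set N x -> normal_set N x^-1.
Proof. by move=> Nx; rewrite -[x^-1]mul1g; apply: NF. Qed.
Let NM x y : normal_set N x -> normal_set N y -> normal_set N (x * y).
Proof. by move=> Nx Ny; rewrite -[y]invgK; apply/NF/NV. Qed.
Let NJ x y : normal_set N x -> normal_set N (x ^ y).
Proof. by case: (normal_setP N) => _; apply. Qed.

Definition coset_eq : rel G := fun x y => `[< normal_set N (x^-1 * y) >].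

Fact coset_eq_refl : reflexive coset_eq.
Proof. by move=> x; apply/asboolP; rewrite mulVg. Qed.

Fact coset_eq_sym : symmetric coset_eq.
Proof.
move=> x y; apply/asboolP/asboolP => /NV; by rewrite invgM invgK.
Qed.

Fact coset_eq_trans : transitive coset_eq.
Proof.
move=> y x z /asboolP Nxy /asboolP Nyz; apply/asboolP.
by move: (NM Nxy Nyz); rewrite mulgA mulgK.
Qed.

Canonical coset_eq_equiv :=
  EquivRel coset_eq coset_eq_refl coset_eq_sym coset_eq_trans.

Definition quotient_group := {eq_quot coset_eq}.
HB.instance Definition _ := Choice.on quotient_group.
HB.instance Definition _ := EqQuotient.on quotient_group.

Definition quot_proj (x : G) : quotient_group := \pi_quotient_group x.

Lemma quot_projP x y :
  quot_proj x = quot_proj y <-> normal_set N (x^-1 * y).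
Proof.
split=> [/eqmodP/asboolP // | Nxy].
by apply/eqmodP/asboolP.
Qed.

Definition quot_mul (a b : quotient_group) : quotient_group :=
  quot_proj (repr a * repr b).
Definition quot_inv (a : quotient_group) : quotient_group :=
  quot_proj (repr a)^-1.

Lemma quot_projM x y :
  quot_proj (x * y) = quot_mul (quot_proj x) (quot_proj y).
Proof.
apply/quot_projP.
set x' := repr _; set y' := repr _.
have /quot_projP Nx : quot_proj x = quot_proj x' by rewrite /quot_proj reprK.
have /quot_projP Ny : quot_proj y = quot_proj y' by rewrite /quot_proj reprK.
have -> : (x * y)^-1 * (x' * y') = (x^-1 * x') ^ y * (y^-1 * y').
  by rewrite conjgE invgM !mulgA mulgK.
exact: NM (NJ _ Nx) Ny.
Qed.

Lemma quot_projV x : quot_proj x^-1 = quot_inv (quot_proj x).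
Proof.
apply/quot_projP; set x' := repr _.
have /quot_projP Nx : quot_proj x' = quot_proj x by rewrite /quot_proj reprK.
have -> : (x^-1)^-1 * x'^-1 = (x'^-1 * x) ^ x'^-1.
  by rewrite conjgE !invgK !mulgA mulgV mul1g.
exact: NJ.
Qed.

Lemma quot_projK (a : quotient_group) : quot_proj (repr a) = a.
Proof. exact: reprK. Qed.

Fact quot_mulA : associative quot_mul.
Proof.
move=> a b c; rewrite -[a]quot_projK -[b]quot_projK -[c]quot_projK.
by rewrite -!quot_projM mulgA.
Qed.

Fact quot_mul1g : left_id (quot_proj 1) quot_mul.
Proof. by move=> a; rewrite -[a]quot_projK -quot_projM mul1g. Qed.

Fact quot_mulg1 : right_id (quot_proj 1) quot_mul.
Proof. by move=> a; rewrite -[a]quot_projK -quot_projM mulg1. Qed.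

Fact quot_mulVg : left_inverse (quot_proj 1) quot_inv quot_mul.
Proof. by move=> a; rewrite -[a]quot_projK -quot_projV -quot_projM mulVg. Qed.

Fact quot_mulgV : right_inverse (quot_proj 1) quot_inv quot_mul.
Proof. by move=> a; rewrite -[a]quot_projK -quot_projV -quot_projM mulgV. Qed.

HB.instance Definition _ := isGroup.Build quotient_group
  quot_mulA quot_mul1g quot_mulg1 quot_mulVg quot_mulgV.

End QuotientGroup.

(* Groups presented by generators X and relations R : a word is a list of    *)
(* signed generators, (x, true) standing for x and (x, false) for x^-1; the  *)
(* presented group is the quotient of the words by the least congruence that *)
(* contains R and the cancellations x x^-1 = x^-1 x = 1.                     *)

Definition word (X : Type) := seq (X * bool).

Section PresentedGroup.
Variables (X : choiceType) (R : word X -> word X -> Prop).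

Inductive word_cong : word X -> word X -> Prop :=
| WordRel u v of R u v : word_cong u v
| WordCancel x b : word_cong [:: (x, b); (x, ~~ b)] [::]
| WordRefl u : word_cong u u
| WordSym u v of word_cong u v : word_cong v u
| WordTrans u v w of word_cong u v & word_cong v w : word_cong u w
| WordCat u u' v v' of word_cong u u' & word_cong v v' :
    word_cong (u ++ v) (u' ++ v').

Definition word_eq : rel (word X) := fun u v => `[< word_cong u v >].

Fact word_eq_refl : reflexive word_eq.
Proof. by move=> u; apply/asboolP/WordRefl. Qed.

Fact word_eq_sym : symmetric word_eq.
Proof. by move=> u v; apply/asboolP/asboolP; apply: WordSym. Qed.

Fact word_eq_trans : transitive word_eq.
Proof.
by move=> v u w /asboolP uv /asboolP vw; apply/asboolP/(WordTrans uv vw).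
Qed.

Canonical word_eq_equiv :=
  EquivRel word_eq word_eq_refl word_eq_sym word_eq_trans.

Definition presented_group := {eq_quot word_eq}.
HB.instance Definition _ := Choice.on presented_group.
HB.instance Definition _ := EqQuotient.on presented_group.

Definition word_class (u : word X) : presented_group := \pi_presented_group u.

Lemma word_classP u v : word_class u = word_class v <-> word_cong u v.
Proof.
split=> [/eqmodP/asboolP // | uv].
by apply/eqmodP/asboolP.
Qed.

Definition word_inv (u : word X) : word X :=
  rev [seq (p.1, ~~ p.2) | p <- u].

Definition pres_mul (a b : presented_group) : presented_group :=
  word_class (repr a ++ repr b).
Definition pres_inv (a : presented_group) : presented_group :=
  word_class (word_inv (repr a)).

Lemma word_classK (a : presented_group) : word_class (repr a) = a.
Proof. exact: reprK. Qed.

Lemma word_class_cat u v :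
  word_class (u ++ v) = pres_mul (word_class u) (word_class v).
Proof. by apply/word_classP/WordCat; apply/word_classP; rewrite word_classK. Qed.

Lemma word_cong_mulV u : word_cong (u ++ word_inv u) [::].
Proof.
elim: u => [|[x b] u IHu]; first exact: WordRefl.
have -> : ((x, b) :: u) ++ word_inv ((x, b) :: u)
        = [:: (x, b)] ++ (u ++ word_inv u) ++ [:: (x, ~~ b)].
  by rewrite /word_inv /= rev_cons -cats1 catA.
apply: WordTrans (WordCancel x b).
apply: (@WordCat _ [:: (x, b)] _ [:: (x, ~~ b)]); first exact: WordRefl.
exact: (@WordCat _ [::] _ [:: (x, ~~ b)] IHu (WordRefl _)).
Qed.

Lemma word_invK : involutive word_inv.
Proof.
move=> u; rewrite /word_inv map_rev revK -map_comp -[RHS]map_id.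
by apply: eq_map => -[x b] /=; rewrite negbK.
Qed.

Fact pres_mulA : associative pres_mul.
Proof.
move=> a b c; rewrite -[a]word_classK -[b]word_classK -[c]word_classK.
by rewrite -!word_class_cat catA.
Qed.

Fact pres_mul1g : left_id (word_class [::]) pres_mul.
Proof. by move=> a; rewrite -[a]word_classK -word_class_cat. Qed.

Fact pres_mulg1 : right_id (word_class [::]) pres_mul.
Proof. by move=> a; rewrite -[a]word_classK -word_class_cat cats0. Qed.

Fact pres_mulgV : right_inverse (word_class [::]) pres_inv pres_mul.
Proof.
move=> a; rewrite -{1}[a]word_classK -word_class_cat.
exact/word_classP/word_cong_mulV.
Qed.

Fact pres_mulVg : left_inverse (word_class [::]) pres_inv pres_mul.
Proof.
move=> a; rewrite -{2}[a]word_classK -word_class_cat.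
apply/word_classP; rewrite -{2}[repr a]word_invK; exact: word_cong_mulV.
Qed.

HB.instance Definition _ := isGroup.Build presented_group
  pres_mulA pres_mul1g pres_mulg1 pres_mulVg pres_mulgV.

End PresentedGroup.

(* Left actions of K on L by automorphisms, i.e. homomorphisms K -> Aut(L);  *)
(* that every [act k] is bijective follows from act1 and actM.               *)
Record autAction (K L : groupType) := AutAction {
  act :> K -> L -> L;
  act1 : forall x, act 1 x = x;
  actM : forall k l x, act (k * l) x = act k (act l x);
  act_morph : forall k, {morph act k : x y / x * y} }.

Definition gen (G H : Type) (g : G) (h : H) : word (G * H) :=
  [:: ((g, h), true)].

Section BoxTensor.
Variables (G H : groupType).
Variables (rhoG : autAction G G) (rhoH : autAction H H).
Variables (sigmaG : autAction G H) (sigmaH : autAction H G).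

Definition union_act (a b : G + H) : G + H :=
  match a, b with
  | inl g, inl g' => inl (rhoG g g')
  | inl g, inr h => inr (sigmaG g h)
  | inr h, inl g => inl (sigmaH h g)
  | inr h, inr h' => inr (rhoH h h')
  end.

Definition union_inv (a : G + H) : G + H :=
  match a with inl g => inl g^-1 | inr h => inr h^-1 end.

Definition fully_compatible := forall a b c : G + H,
  union_act (union_act a b) c
  = union_act a (union_act b (union_act (union_inv a) c)).

Inductive box_relation : word (G * H) -> word (G * H) -> Prop :=
| BoxMulLeft g g' h :
    box_relation (gen (g * g') h) (gen (rhoG g g') (sigmaG g h) ++ gen g h)
| BoxMulRight g h h' :
    box_relation (gen g (h * h')) (gen g h ++ gen (sigmaH h g) (rhoH h h')).

Definition box_tensor : groupType := presented_group box_relation.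

Definition box (g : G) (h : H) : box_tensor := word_class _ (gen g h).

Lemma boxMl g g' h : box (g * g') h = box (rhoG g g') (sigmaG g h) * box g h.
Proof.
rewrite [RHS](esym (word_class_cat _ _ _)).
exact/word_classP/WordRel/BoxMulLeft.
Qed.

Lemma boxMr g h h' : box g (h * h') = box g h * box (sigmaH h g) (rhoH h h').
Proof.
rewrite [RHS](esym (word_class_cat _ _ _)).
exact/word_classP/WordRel/BoxMulRight.
Qed.

Definition derivative : set G :=
  generated [set x | exists g h, x = g * sigmaH h g^-1].

Definition deviational_set : set G :=
  normal_closure [set x | exists g g', x = rhoG g g' * (g * g'^-1 * g^-1)].

Definition deviational : normalSubgroup G :=
  NormalSubgroup (normal_closure_normal _ : normal_subgroup deviational_set).

Definition derivative_bar : set (quotient_group deviational) :=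
  @quot_proj G deviational @`
    [set x * y | x in derivative & y in deviational_set].

End BoxTensor.

Arguments derivative {G H} sigmaH _.
Arguments deviational_set {G} rhoG _.
Arguments deviational {G} rhoG.
Arguments derivative_bar {G H} rhoG sigmaH _.

(* Main.v *)
Require Import Defs.
From mathcomp Require Import all_boot.
From mathcomp Require Import boolp classical_sets.
From mathcomp Require Import cardinality.

(** Expanding [gg' box hh'] with the two defining relations in either order
    shows that conjugation by [g box h] acts on the generators
    of the box-tensor product as the element [g . ^h(g^-1)] of the derivative.
    The deviational subgroup acts trivially, so up to central elements [x] in
    the product is determined by a class in [derivative_bar].  Two generators
    give two classes in a common cyclic subgroup, hence agree up to central
    elements with commuting elements, and therefore commute. *)

Set Implicit Arguments.
Unset Strict Implicit.
Unset Printing Implicit Defensive.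

Local Open Scope classical_set_scope.
Local Open Scope group_scope.

Section Generated.
Variable G : groupType.
Implicit Types (A S : set G).

Lemma generated_min A S : subgroup S -> A `<=` S -> generated A `<=` S.
Proof. by move=> sgS AS x; apply. Qed.

Lemma sub_generated A : A `<=` generated A.
Proof. by move=> x Ax S [_]; apply. Qed.

Lemma generated_subgroup A : subgroup (generated A).
Proof.
apply/subgroupP; split; first by move=> S [/subgroupP[]].
move=> x y Ax Ay S SA; have [/subgroupP[_ SF] _] := SA.
by apply: SF; [apply: Ax | apply: Ay].
Qed.

End Generated.

(** * Commuting lifts over locally cyclic subgroups *)

Section LocallyCyclic.
Variable G : groupType.
Implicit Types (S : set G).

Lemma locally_cyclic_pair S a b : subgroup S -> locally_cyclic S ->
  S a -> S b -> exists c, generated [set a; b] = generated [set c].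
Proof.
move=> sgS lcS Sa Sb; apply: lcS.
  by apply: generated_min => // _ [] ->.
by exists [set a; b] => //; apply: finite_set2.
Qed.

(* A relation that is a subgroup of the product [G * K] is viewed as a partial
   multivalued homomorphism from [G] to [K]: on a cyclic subgroup of [G] its
   values can be chosen to commute. *)
Lemma locally_cyclic_commuting_lifts (K : groupType) (r : G -> K -> Prop) S a b x y :
  r 1 1 ->
  (forall c d u v, r c u -> r d v -> r (c / d) (u / v)) ->
  subgroup S -> locally_cyclic S -> S a -> S b -> r a x -> r b y ->
  exists u v, [/\ r a u, r b v & u * v = v * u].
Proof.
move=> r1 rF sgS lcS Sa Sb rax rby.
have [c abc] := locally_cyclic_pair sgS lcS Sa Sb.
(* The elements with a lift form a subgroup containing [a] and [b], hence [c]. *)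
have [z rcz] : exists z, r c z.
  have : generated [set a; b] c by rewrite abc; apply: sub_generated.
  apply: (generated_min (S := [set e | exists z, r e z])).
    apply/subgroupP; split; first by exists 1.
    by move=> e f [u reu] [v rfv]; exists (u / v); apply: rF.
  by move=> _ [] ->; [exists x | exists y].
(* The elements with a lift commuting with [w] form a subgroup, which contains [c] by way of [z].
   Taking [w] as [z] yields [u]; taking [w] as [u] then yields [v]. *)
have lift w e : w * z = z * w -> generated [set c] e ->
    exists2 u, r e u & w * u = u * w.
  move=> wz; apply: (generated_min
    (S := [set e | exists2 u, r e u & w * u = u * w])).
    apply/subgroupP; split; first by exists 1; rewrite ?mulg1 ?mul1g.
    move=> e1 e2 [u1 r1u cu1] [u2 r2u cu2]; exists (u1 / u2); first exact: rF.
    exact/commuteM/commuteV.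
  by move=> _ ->; exists z.
have [u rau zu] : exists2 u, r a u & z * u = u * z.
  by apply: lift => //; rewrite -abc; apply: sub_generated; left.
have [v rbv uv] : exists2 v, r b v & u * v = v * u.
  by apply: lift => //; rewrite -abc; apply: sub_generated; right.
by exists u, v.
Qed.

End LocallyCyclic.

Section Actions.
Variables (K L : groupType) (f : autAction K L).

Lemma actK k : cancel (f k) (f k^-1).
Proof. by move=> x; rewrite -actM mulVg act1. Qed.

Lemma actVK k : cancel (f k^-1) (f k).
Proof. by move=> x; rewrite -actM mulgV act1. Qed.

End Actions.

(** * Conjugation in the box-tensor product *)

Section BoxTensorTheory.
Variables (G H : groupType).
Variables (rhoG : autAction G G) (rhoH : autAction H H).
Variables (sigmaG : autAction G H) (sigmaH : autAction H G).
Local Notation uact := (union_act rhoG rhoH sigmaG sigmaH).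
Local Notation B := (box_tensor rhoG rhoH sigmaG sigmaH).
Local Notation box := (box rhoG rhoH sigmaG sigmaH).

Lemma box_ind (P : B -> Prop) :
  P 1 -> (forall g h, P (box g h)) -> (forall x, P x -> P x^-1) ->
  (forall x y, P x -> P y -> P (x * y)) -> forall x, P x.
Proof.
move=> P1 Pbox PV PM x; rewrite -[x]word_classK; move: (repr x) => {x}.
elim=> [//|[[g h] b] u IHu].
rewrite -cat1s word_class_cat; apply: PM => //; case: b; first exact: Pbox.
have -> : word_class (box_relation rhoG rhoH sigmaG sigmaH) [:: ((g, h), false)]
    = (box g h)^-1 :> B.
  apply: (mulgI (box g h)); rewrite mulgV.
  rewrite [LHS](esym (word_class_cat _ _ _)).
  exact/word_classP/(WordCancel _ _ true).
exact/PV/Pbox.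
Qed.

Hypothesis fc : fully_compatible rhoG rhoH sigmaG sigmaH.

(** The inner [union_inv a] of full compatibility cancels against [uact a c]. *)
Lemma union_act_equivariant a b c :
  uact (uact a b) (uact a c) = uact a (uact b c).
Proof.
rewrite fc; congr (uact a (uact b _)).
by case: a c => [g|h] [g'|h'] /=; rewrite actK.
Qed.

Lemma rhoG_rhoG u g x : rhoG (rhoG u g) x = rhoG u (rhoG g (rhoG u^-1 x)).
Proof. by case: (fc (inl u) (inl g) (inl x)). Qed.

Lemma sigmaG_rhoG u g x :
  sigmaG (rhoG u g) x = sigmaG u (sigmaG g (sigmaG u^-1 x)).
Proof. by case: (fc (inl u) (inl g) (inr x)). Qed.

Lemma rhoG_sigmaH h g x :
  rhoG (sigmaH h g) x = sigmaH h (rhoG g (sigmaH h^-1 x)).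
Proof. by case: (fc (inr h) (inl g) (inl x)). Qed.

Lemma sigmaG_sigmaH h g x :
  sigmaG (sigmaH h g) x = rhoH h (sigmaG g (rhoH h^-1 x)).
Proof. by case: (fc (inr h) (inl g) (inr x)). Qed.

Lemma sigmaH_sigmaG g h x :
  sigmaH (sigmaG g h) (rhoG g x) = rhoG g (sigmaH h x).
Proof. by case: (union_act_equivariant (inl g) (inr h) (inl x)). Qed.

Lemma rhoH_sigmaG g h x :
  rhoH (sigmaG g h) (sigmaG g x) = sigmaG g (rhoH h x).
Proof. by case: (union_act_equivariant (inl g) (inr h) (inr x)). Qed.

Lemma box_swap g h g' h' :
  box (rhoG g (sigmaH h g')) (sigmaG g (rhoH h h')) * box g h
  = box g h * box (sigmaH h (rhoG g g')) (rhoH h (sigmaG g h')).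
Proof.
have := boxMl rhoG rhoH sigmaG sigmaH g g' (h * h').
rewrite boxMr boxMl !act_morph boxMl !boxMr.
rewrite rhoG_sigmaH actK sigmaG_sigmaH actK sigmaH_sigmaG rhoH_sigmaG.
(* Both expansions begin with [box (rhoG g g') (sigmaG g h)] and end with
   [box (sigmaH h g) (rhoH h h')]; cancelling these leaves the claim. *)
by rewrite -!mulgA => /mulgI; rewrite !mulgA => /mulIg.
Qed.

(** A relation, so that neither a homomorphism from [B] to [G] nor an action of [G] on [B] has to be
    constructed. *)
Definition conj_acts (u : G) (x : B) :=
  forall g h, x * box g h = box (rhoG u g) (sigmaG u h) * x.

(** By compatibility [g * sigmaH h g^-1] acts as the commutator of the actions of [g] and [h], which
    is how the two sides of [box_swap] differ. *)
Lemma conj_acts_box g h : conj_acts (g * sigmaH h g^-1) (box g h).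
Proof.
move=> g' h'; rewrite !actM rhoG_sigmaH sigmaG_sigmaH box_swap.
by rewrite !actVK.
Qed.

Lemma conj_acts1 : conj_acts 1 1.
Proof. by move=> g h; rewrite !act1 mulg1 mul1g. Qed.

Lemma conj_actsF u v x y :
  conj_acts u x -> conj_acts v y -> conj_acts (u / v) (x / y).
Proof.
move=> ux vy g h; rewrite !actM -!mulgA.
have -> : y^-1 * box g h = box (rhoG v^-1 g) (sigmaG v^-1 h) * y^-1.
  by apply: (mulgI y); apply: (mulIg y); rewrite !mulgA mulgV mul1g vy !actVK mulgVK.
by rewrite mulgA ux !mulgA.
Qed.

(** Two inner automorphisms that agree on the generators are equal, so [x] and [y] differ by a
    central element. *)
Lemma conj_acts_inj u x y z : conj_acts u x -> conj_acts u y ->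
  x * z * x^-1 = y * z * y^-1.
Proof.
move=> ux uy; elim/box_ind: z => [|g h|z e|z t ez et].
- by rewrite !mulg1 !mulgV.
- by rewrite ux uy !mulgK.
- by apply: invg_inj; rewrite !invgM !invgK !mulgA.
- have M w : w * (z * t) * w^-1 = (w * z * w^-1) * (w * t * w^-1).
    by rewrite !mulgA mulgVK.
  by rewrite !M ez et.
Qed.

Lemma deviational_act_trivial u : deviational_set rhoG u ->
  (forall g, rhoG u g = g) /\ (forall h, sigmaG u h = h).
Proof.
(* The kernel of both actions is normal. It contains the generators because, by compatibility,
   [rhoG g g'] acts as [g * g' * g^-1]. *)
move=> /(_ [set v | (forall g, rhoG v g = g) /\ (forall h, sigmaG v h = h)]); apply.
split; first split; first apply/subgroupP.
- split=> [|v w [rv sv] [rw sw]]; first by split=> x; rewrite act1.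
  split=> x; rewrite actM.
    by rewrite -{1}(rw x) actK rv.
  by rewrite -{1}(sw x) actK sv.
- by move=> v w [rv sv]; split=> x; rewrite conjgE !actM ?rv ?sv actK.
- move=> _ [g [g' ->]]; split=> x.
    by rewrite !actM rhoG_rhoG !(actK, actVK).
  by rewrite !actM sigmaG_rhoG !(actK, actVK).
Qed.

Lemma conj_acts_quot u v x :
  quot_proj (deviational rhoG) u = quot_proj (deviational rhoG) v ->
  conj_acts u x -> conj_acts v x.
Proof.
move=> /quot_projP /deviational_act_trivial[r s] ux g h.
by rewrite ux -{1}(r g) -{1}(s h) -!actM mulVKg.
Qed.

(** The relation is moved to the quotient, where local cyclicity is assumed, to serve as [r] in
    [locally_cyclic_commuting_lifts]. *)
Definition conj_acts_bar (c : quotient_group (deviational rhoG)) (x : B) :=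
  exists2 u, quot_proj _ u = c & conj_acts u x.

Lemma conj_acts_bar1 : conj_acts_bar 1 1.
Proof. by exists 1 => //; apply: conj_acts1. Qed.

Lemma conj_acts_barF c d x y :
  conj_acts_bar c x -> conj_acts_bar d y -> conj_acts_bar (c / d) (x / y).
Proof.
move=> [u <- ux] [v <- vy]; exists (u / v); last exact: conj_actsF.
by rewrite quot_projM quot_projV.
Qed.

Lemma conj_acts_bar_inj c x y z : conj_acts_bar c x -> conj_acts_bar c y ->
  x * z * x^-1 = y * z * y^-1.
Proof.
move=> [u <- ux] [v vu vy]; apply: conj_acts_inj ux _.
exact: conj_acts_quot vu vy.
Qed.

Lemma derivative_barE :
  derivative_bar rhoG sigmaH = quot_proj _ @` derivative sigmaH.
Proof.
have /subgroupP[N1 NF] := (normal_closure_normal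
  [set x | exists g g', x = rhoG g g' * (g * g'^-1 * g^-1)]).1.
rewrite eqEsubset; split=> z [x].
  case=> d Dd [n Nn <-] <-; exists d => //.
  by apply/quot_projP; rewrite mulKg.
by move=> Dx <-; exists x => //; exists x => //; exists 1; rewrite ?mulg1.
Qed.

Lemma derivative_bar_subgroup : subgroup (derivative_bar rhoG sigmaH).
Proof.
have /subgroupP[D1 DF] := generated_subgroup
  [set x | exists g h, x = g * sigmaH h g^-1].
rewrite derivative_barE; apply/subgroupP; split; first by exists 1.
move=> _ _ [x Dx <-] [y Dy <-]; exists (x / y); first exact: DF.
by rewrite quot_projM quot_projV.
Qed.

Lemma derivative_bar_gen g h :
  derivative_bar rhoG sigmaH (quot_proj _ (g * sigmaH h g^-1)).
Proof.
rewrite derivative_barE; exists (g * sigmaH h g^-1) => //.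
by apply: sub_generated; exists g, h.
Qed.

Lemma box_commute g h g' h' :
  locally_cyclic (derivative_bar rhoG sigmaH) ->
  box g h * box g' h' = box g' h' * box g h.
Proof.
move=> lc.
have acts k l : conj_acts_bar (quot_proj _ (k * sigmaH l k^-1)) (box k l).
  by exists (k * sigmaH l k^-1) => //; apply: conj_acts_box.
have [u [v [ru rv uv]]] := locally_cyclic_commuting_lifts conj_acts_bar1
  conj_acts_barF derivative_bar_subgroup lc (derivative_bar_gen g h)
  (derivative_bar_gen g' h') (acts g h) (acts g' h').
(* [box g' h'] conjugates as [v] does, and [v] fixes [u]; below, [box g h] likewise conjugates as
   [u] does. *)
have tu : box g' h' * u = u * box g' h'.
  apply: (mulIg (box g' h')^-1).
  by rewrite (conj_acts_bar_inj u (acts g' h') rv) -uv !mulgK.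
apply: (mulIg (box g h)^-1).
by rewrite (conj_acts_bar_inj _ (acts g h) ru) -tu !mulgK.
Qed.

End BoxTensorTheory.

Theorem theorem3p12 (G H : groupType)
    (rhoG : autAction G G) (rhoH : autAction H H)
    (sigmaG : autAction G H) (sigmaH : autAction H G) :
  fully_compatible rhoG rhoH sigmaG sigmaH ->
  locally_cyclic (derivative_bar rhoG sigmaH) ->
  forall x y : box_tensor rhoG rhoH sigmaG sigmaH, (x * y = y * x)%g.
Proof.
(* Centralizers are subgroups, so induction on [y] and then on [x] leaves only pairs of
   generators. *)
move=> fc lc x; apply: box_ind => [|g h|y|y z]; first exact: commute1.
- apply: commute_sym; elim/box_ind: x => [|g' h'|x|x y].
  + exact: commute1.
  + exact: box_commute.
  + exact: commuteV.
  + exact: commuteM.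
- exact: commuteV.
- exact: commuteM.
Qed.
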